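(* Let $m,n$ be positive integers with $m\nmid n$ and $\gcd(m,n)\ne 1$, and let $G=\mathbb{Z}_m\times\mathbb{Z}_n$. Let $S=\{d_1,\dots,d_k\}$ be the set of all divisors of $n$ and $S'=\{\xi_1,\dots,\xi_s\}$ the set of all divisors of $m$, indexed so that $S\cap S'=\{d_{r+1},\dots,d_{k}\}=\{\xi_{t+1},\dots,\xi_{s}\}$, where $k=r+h$ and $s=t+h$ with $h=|S\cap S'|$. Let $T=\{d_i\xi_j:\gcd(d_i,\xi_j)=1,\ 1\le i\le k,\ 1\le j\le s\}$ and $T'=T\setminus(S\cup S')$. Let $n_i$, $m_j$, $\eta_a$ be the numbers of cyclic subgroups of $G$ of order $d_i$, $\xi_j$, $a$ respectively, and let $\langle(a_1,b_1)\rangle,\dots,\langle(a_l,b_l)\rangle$ be all the distinct cyclic subgroups of $G$. Then $$\psi(A(\mathscr{P}(G)),x)=(1+x)^{\alpha}\,\psi(Q,x),$$ where $$\alpha=\sum_{i=1}^{k}n_i(\phi(d_i)-1)+\sum_{j=1}^{t}m_j(\phi(\xi_j)-1)+\sum_{a\in T'}\eta_a(\phi(a)-1)$$ and $Q=(q_{ij})_{l\times l}$ with $$q_{ij}=\begin{cases}\phi(|\langle(a_j,b_j)\rangle|) & \text{if } i\ne j \text{ and } T_{\langle(a_i,b_i)\rangle}\sim T_{\langle(a_j,b_j)\rangle},\\ \phi(|\langle(a_i,b_i)\rangle|)-1 & \text{if } i=j,\\ 0&\text{otherwise.}\end{cases}$$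
   Context: For a finite group $G$, the power graph $\mathscr{P}(G)$ is the simple graph with vertex set $G$ in which two distinct vertices $x,y$ are adjacent iff $x=y^k$ or $y=x^k$ for some $k\in\mathbb{N}$. $A(H)$ is the adjacency matrix of a graph $H$; for a square matrix $N$, $\psi(N,x)=\det(xI-N)$. $\phi$ is Euler's totient function. For a cyclic subgroup $C$, $T_C$ (with a subgroup as subscript) denotes the set of all generators of $C$. For disjoint vertex sets $X,Y$, $X\sim Y$ means every vertex of $X$ is adjacent to every vertex of $Y$ (in $\mathscr{P}(G)$). *)

(* Defs.v *)
From HB Require Import structures.
From mathcomp Require Export all_boot all_order all_algebra all_fingroup.
From mathcomp Require Export all_solvable finmap boolp.

Set Implicit Arguments.
Unset Strict Implicit.
Unset Printing Implicit Defensive.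

Local Open Scope group_scope.

Definition power_adj (gT : finGroupType) : rel gT := fun x y =>
  `[< x <> y /\ ((exists k : nat, x = y ^+ k) \/ (exists k : nat, y = x ^+ k)) >].

(* The vertices are numbered by [enum_val]; any other numbering gives a matrix
   conjugate to this one by a permutation matrix. *)
Definition adjacency_mx (V : finType) (e : rel V) : 'M[int]_#|V| :=
  (\matrix_(i, j) (e (enum_val i) (enum_val j))%:R)%R.

Definition generators (gT : finGroupType) (C : {set gT}) : {set gT} :=
  [set x | generator C x].

Definition fully_joined (V : finType) (e : rel V) (X Y : {set V}) : bool :=
  [forall x in X, forall y in Y, e x y].

Definition nb_cyclic (gT : finGroupType) (a : nat) : nat :=
  #|[set C : {group gT} | cyclic C & #|C| == a]|.

Definition divisor_set (n : nat) : {fset nat} := [fset a in divisors n]%fset.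

Definition coprime_products (S S' : {fset nat}) : {fset nat} :=
  [fset (a * b)%N | a in S, b in S' & coprime a b]%fset.

Definition quotient_mx (gT : finGroupType) (l : nat) (c : 'I_l -> gT) :
    'M[int]_l :=
  (\matrix_(i, j)
    if i == j then (totient #|<[c i]>|)%:R - 1
    else if fully_joined (@power_adj gT) (generators <[c i]>)
                         (generators <[c j]>)
         then (totient #|<[c j]>|)%:R
    else 0)%R.

(* Main.v *)
(** Two elements generating the same cyclic subgroup are adjacent and have the
    same neighbours, so if [U] is the incidence matrix between elements and
    cyclic subgroups (element generates subgroup) and [F] the comparability
    matrix of the cyclic subgroups, then [A + 1 = U F U^T] while
    [Q + 1 = F U^T U].  Since [det (y - M N)] and [det (y - N M)] differ only by
    a power of [y], the two characteristic polynomials differ by the power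
    [|G| - l] of [1 + x].  This exponent is the sum of [phi(|C|) - 1] over the
    cyclic subgroups [C], which is [alpha] once they are sorted by their order:
    each order divides [lcm(m, n)], hence lies in [T]. *)
Require Import Defs.

Set Implicit Arguments.
Unset Strict Implicit.
Unset Printing Implicit Defensive.

Import GRing.Theory.
Local Open Scope ring_scope.

(** * Determinants of products taken in the two orders *)

Lemma det_scalar_sub_mulmxC (R : comNzRingType) (p q : nat) (y : R)
    (M : 'M[R]_(p, q)) (N : 'M[R]_(q, p)) :
  y ^+ q * \det (y%:M - M *m N) = y ^+ p * \det (y%:M - N *m M).
Proof.
(* Clearing the lower left block of [B] by a triangular factor on the right leaves [y - M N];
   clearing it by one on the left, of determinant [y ^+ q], leaves [y - N M] without dividing by
   [y]. *)
pose B := block_mx y%:M M N 1%:M.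
have detl : \det B = \det (y%:M - M *m N).
  transitivity (\det (B *m block_mx 1%:M 0 (- N) 1%:M)).
    by rewrite det_mulmx det_lblock !det1 !mulr1.
  rewrite mulmx_block !mulmx1 !mulmx0 !mul1mx add0r add0r mulmxN subrr.
  by rewrite det_ublock det1 mulr1.
have detr : \det (y%:M - N *m M) * y ^+ p = y ^+ q * \det B.
  transitivity (\det (block_mx 1%:M 0 (- N) y%:M *m B)); last first.
    by rewrite det_mulmx det_lblock det1 mul1r det_scalar.
  rewrite mulmx_block !mulmx1 !mul0mx !mul1mx !addr0 mulNmx.
  rewrite scalar_mxC mul_scalar_mx mulNmx -mul_scalar_mx addNr.
  by rewrite det_ublock det_scalar mulrC (addrC (- _)).
by rewrite -detl -detr mulrC.
Qed.

(** The identity matrix shifts the variable: ['X - (A - 1) = (1 + 'X) - A]. The common factor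
    [(1 + 'X) ^+ q] then cancels over an integral domain. *)
Lemma char_poly_sub1_mulmxC (R : idomainType) (p q : nat)
    (M : 'M[R]_(p, q)) (N : 'M[R]_(q, p)) : (q <= p)%N ->
  char_poly (M *m N - 1%:M) = (1 + 'X) ^+ (p - q) * char_poly (N *m M - 1%:M).
Proof.
move=> le_qp.
have shift n (A : 'M[R]_n) :
    char_poly_mx (A - 1%:M) = (1 + 'X)%:M - map_mx polyC A.
  rewrite /char_poly_mx map_mxB map_scalar_mx opprB addrCA addrA.
  by rewrite -(raddfD scalar_mx).
have y_neq0 : (1 + 'X : {poly R}) ^+ q != 0.
  by rewrite expf_neq0 // addrC -polyC1 -size_poly_eq0 size_XaddC.
apply: (mulfI y_neq0); rewrite /char_poly !shift !map_mxM.
by rewrite det_scalar_sub_mulmxC mulrA -exprD subnKC.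
Qed.

(** * Cyclic subgroups and the matrices of the power graph *)

Section CyclicSubgroups.

Variables (gT : finGroupType) (l : nat) (c : 'I_l -> gT).
Hypothesis c_inj : injective (fun i => <[c i]>%g).
Hypothesis c_enum : forall C : {group gT},
  cyclic C -> exists i, C = <[c i]>%g :> {set gT}.

Lemma generator_index (x : gT) :
  exists i, forall j, generator <[c j]>%g x = (j == i).
Proof.
have [i xi] := c_enum (cycle_cyclic x); exists i => j.
apply/eqP/eqP => [cj | ->]; last exact: esym.
by apply: c_inj; rewrite /= cj xi.
Qed.

Definition generator_mx : 'M[int]_(#|gT|, l) :=
  \matrix_(a, j) (generator <[c j]>%g (enum_val a))%:R.

Definition comparable_mx : 'M[int]_l :=
  \matrix_(i, j)
    ((<[c i]> \subset <[c j]>) || (<[c j]> \subset <[c i]>))%g%:R.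

(** In a finite group the natural powers of [y] fill [<[y]>], so adjacency of distinct vertices
    depends only on the subgroups that they generate. *)
Lemma power_adjE (x y : gT) :
  power_adj x y
  = (x != y) && ((<[x]> \subset <[y]>) || (<[y]> \subset <[x]>))%g.
Proof.
rewrite !cycle_subG; apply/asboolP/andP => [[/eqP xy H] | [/eqP xy H]];
  split=> //.
  by case: H => /cycleP ->; rewrite ?orbT.
by case/orP: H => /cycleP; [left | right].
Qed.

Lemma adjacency_mx_factor :
  adjacency_mx (@power_adj gT)
  = generator_mx *m (comparable_mx *m generator_mx^T) - 1%:M.
Proof.
apply/matrixP=> a b; rewrite !mxE power_adjE (inj_eq enum_val_inj).
have [i ia] := generator_index (enum_val a).
have [j jb] := generator_index (enum_val b).
rewrite (bigD1 i) //= big1 ?addr0; last first.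
  by move=> k /negPf ki; rewrite !mxE ia ki mul0r.
rewrite !mxE ia eqxx mul1r (bigD1 j) //= big1 ?addr0; last first.
  by move=> k /negPf kj; rewrite !mxE jb kj mulr0.
rewrite !mxE jb eqxx mulr1.
have /eqP <- : generator <[c i]>%g (enum_val a) by rewrite ia.
have /eqP <- : generator <[c j]>%g (enum_val b) by rewrite jb.
(* On the diagonal the product has entry 1 although no vertex is its own neighbour; the subtracted
   identity corrects this. *)
have [eq_ab|_] /= := eqVneq a b; last by rewrite subr0.
suff -> : i = j by rewrite subxx subrr.
by apply/eqP; rewrite -jb -eq_ab ia.
Qed.

(** Distinct cyclic subgroups share no generator, so the columns are orthogonal; the squared norm of
    a column counts generators. *)
Lemma generator_mx_gram :
  generator_mx^T *m generator_mx = diag_mx (\row_j (totient #[c j]%g)%:R).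
Proof.
apply/matrixP=> i j; rewrite !mxE.
transitivity (\sum_(x : gT)
    (generator <[c i]>%g x)%:R * (generator <[c j]>%g x)%:R : int).
  rewrite (reindex _ (onW_bij _ (@enum_val_bij gT))).
  by apply: eq_bigr => a _; rewrite !mxE.
have [<-|ij] := eqVneq i j.
  rewrite mulr1n totient_gen -sum1_card natr_sum [RHS]big_mkcond /=.
  by apply: eq_bigr => x _; rewrite inE; case: generator.
rewrite mulr0n big1 // => x _; have [k kx] := generator_index x.
rewrite !kx; case: (i =P k) ij => [->|_ _]; last by rewrite mul0r.
by rewrite eq_sym => /negPf ->; rewrite mulr0.
Qed.

(** One pair of generators decides for all pairs. With [i = j] a generator would have to be adjacent
    to itself. *)
Lemma fully_joined_generators (i j : 'I_l) : i != j ->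
  fully_joined (@power_adj gT) (generators <[c i]>%g) (generators <[c j]>%g)
  = ((<[c i]> \subset <[c j]>) || (<[c j]> \subset <[c i]>))%g.
Proof.
move=> ij; have gen k : c k \in generators <[c k]>%g by rewrite inE /generator.
apply/forall_inP/idP => [joined | cij x].
  have /forall_inP/(_ _ (gen j)) := joined _ (gen i).
  by rewrite power_adjE => /andP[].
rewrite inE => /eqP ix; apply/forall_inP=> y; rewrite inE => /eqP jy.
rewrite power_adjE -ix -jy cij andbT; apply: contra ij => /eqP xy.
by apply/eqP/c_inj; rewrite /= ix jy xy.
Qed.

Lemma quotient_mx_factor :
  quotient_mx c = (comparable_mx *m generator_mx^T) *m generator_mx - 1%:M.
Proof.
rewrite -mulmxA generator_mx_gram mul_mx_diag; apply/matrixP=> i j.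
rewrite !mxE; have [<-|ij] := eqVneq i j; first by rewrite subxx mul1r.
by rewrite fully_joined_generators // subr0; case: ifP; rewrite ?mul1r ?mul0r.
Qed.

(** Each element generates exactly one of the listed subgroups. *)
Lemma sum_totient_cyclic : (\sum_i totient #[c i]%g)%N = #|gT|.
Proof.
transitivity (\sum_i \sum_(x : gT) (generator <[c i]>%g x : nat))%N.
  apply: eq_bigr => i _; rewrite totient_gen -sum1_card big_mkcond /=.
  by apply: eq_bigr => x _; rewrite inE; case: generator.
rewrite exchange_big /= -sum1_card; apply: eq_bigr => x _.
have [i ix] := generator_index x; rewrite (bigD1 i) //= ix eqxx big1 // => j.
by rewrite ix => /negPf ->.
Qed.

Lemma sum_totient_sub1_cyclic :
  (\sum_i (totient #[c i]%g - 1))%N = (#|gT| - l)%N.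
Proof.
(* Each totient is at least 1, so the truncated subtractions are exact. *)
rewrite -sum_totient_cyclic sumnB; last by move=> i _; rewrite totient_gt0.
by rewrite sum_nat_const card_ord muln1.
Qed.

Lemma nb_cyclicE (a : nat) : nb_cyclic gT a = (\sum_i (#[c i]%g == a))%N.
Proof.
rewrite -big_mkcond sum1_card /=.
have cG_inj : injective (fun i => <[c i]>%G) by move=> i j [] /c_inj.
rewrite -(card_imset _ cG_inj); apply: eq_card => C; rewrite inE.
apply/andP/imsetP => [[cC oC] | [i oi ->]]; last by rewrite cycle_cyclic.
have [i Ci] := c_enum cC.
by exists i; [rewrite -topredE /= /order -Ci | apply: val_inj].
Qed.

(** The order of each [c i] occurs exactly once in [O]; a member of [O] that is no element order
    contributes 0. *)
Lemma sum_nb_cyclic (O : {fset nat}) (g : nat -> nat) :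
    (forall x : gT, #[x]%g \in O) ->
  (\sum_(a <- O) nb_cyclic gT a * g a)%N = (\sum_i g #[c i]%g)%N.
Proof.
move=> ordO.
under eq_bigr do rewrite nb_cyclicE big_distrl /=.
rewrite exchange_big /=; apply: eq_bigr => i _.
rewrite (big_fsetD1 #[c i]%g) //= eqxx mul1n big_seq big1 ?addn0 // => a.
by rewrite !inE eq_sym => /andP[/negPf ->].
Qed.

Lemma char_poly_power_graph (O : {fset nat}) :
    (forall x : gT, #[x]%g \in O) ->
  char_poly (adjacency_mx (@power_adj gT))
  = (1 + 'X) ^+ (\sum_(a <- O) nb_cyclic gT a * (totient a - 1))%N
    * char_poly (quotient_mx c).
Proof.
move=> ordO; rewrite (sum_nb_cyclic (fun a => totient a - 1)%N ordO).
rewrite sum_totient_sub1_cyclic adjacency_mx_factor quotient_mx_factor.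
apply: char_poly_sub1_mulmxC.
rewrite -sum_totient_cyclic -[l in (l <= _)%N]card_ord -sum1_card.
by apply: leq_sum => i _; rewrite totient_gt0.
Qed.

End CyclicSubgroups.

(** * Element orders in the product of two cyclic groups *)

Lemma dvdn_lcm_coprime_factor (m n a : nat) :
    (0 < m)%N -> (0 < n)%N -> (a %| lcmn m n)%N ->
  exists u v, [/\ u %| n, v %| m, coprime u v & a = u * v]%N.
Proof.
move=> m_gt0 n_gt0 a_dvd.
have mn_gt0 : (0 < lcmn m n)%N by rewrite lcmn_gt0 m_gt0.
have a_gt0 := dvdn_gt0 mn_gt0 a_dvd.
(* A prime goes to [u] if its exponent in [n] is at least that in [m], and to [v] otherwise. The
   larger exponent is the one in the lcm, so it bounds the exponent in [a]. *)
pose pi : nat_pred := [pred p | logn p m <= logn p n]%N.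
exists (a`_pi)%N, (a`_pi^')%N; split; rewrite ?coprime_partC ?partnC //.
  apply/dvdn_partP=> [|p]; first exact: part_gt0.
  rewrite pi_of_part // !inE => /andP[p_a p_pi].
  have p_pr : prime p by move: p_a; rewrite mem_primes => /andP[].
  rewrite p_part pfactor_dvdn //.
  apply: leq_trans (dvdn_leq_log p a_gt0 (dvdn_part _ _)) _.
  apply: leq_trans (dvdn_leq_log p mn_gt0 a_dvd) _.
  by rewrite logn_lcm // geq_max p_pi leqnn.
apply/dvdn_partP=> [|p]; first exact: part_gt0.
rewrite pi_of_part // !inE -ltnNge => /andP[p_a p_pi].
have p_pr : prime p by move: p_a; rewrite mem_primes => /andP[].
rewrite p_part pfactor_dvdn //.
apply: leq_trans (dvdn_leq_log p a_gt0 (dvdn_part _ _)) _.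
apply: leq_trans (dvdn_leq_log p mn_gt0 a_dvd) _.
by rewrite logn_lcm // geq_max leqnn (ltnW p_pi).
Qed.

Lemma order_Zp_prod_dvd (m n : nat) (x : ('Z_m * 'Z_n)%type) :
  (1 < m)%N -> (1 < n)%N -> (#[x]%g %| lcmn m n)%N.
Proof.
move=> m_gt1 n_gt1; rewrite order_dvdn; apply/eqP.
have expE k : (x ^+ k = (x.1 ^+ k, x.2 ^+ k))%g.
  by elim: k => [|k IHk]; rewrite ?expg0 // !expgS IHk.
(* The bound [1 < p] gives ['Z_p] exactly [p] elements; for smaller [p] the type has two. *)
have Zp_exp p (u : 'Z_p) : (1 < p)%N -> (p %| lcmn m n)%N ->
    (u ^+ lcmn m n = 1)%g.
  move=> p_gt1 p_dvd; apply/eqP; rewrite -order_dvdn (dvdn_trans _ p_dvd) //.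
  rewrite -[X in (_ %| X)%N](Zp_cast p_gt1) -[X in (_ %| X)%N]card_ord -cardsT.
  by rewrite order_dvdG ?inE.
by rewrite expE !Zp_exp ?dvdn_lcml ?dvdn_lcmr.
Qed.

Lemma big_fsetU_disjoint (R : Type) (idx : R) (op : Monoid.com_law idx)
    (I : choiceType) (A B : {fset I}) (F : I -> R) : [disjoint A & B]%fset ->
  \big[op/idx]_(i <- (A `|` B)%fset) F i =
  op (\big[op/idx]_(i <- A) F i) (\big[op/idx]_(i <- B) F i).
Proof.
move=> dAB; rewrite -big_cat; apply/perm_big/uniq_perm => [||i].
- exact: fset_uniq.
- rewrite cat_uniq !fset_uniq andbT; apply/hasPn => i iB.
  by move: dAB; rewrite fdisjoint_sym => /fdisjointP; exact.
- by rewrite mem_cat inE.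
Qed.

(* The hypotheses force 1 < m and 1 < n, so 'Z_m and 'Z_n really are the
   integers modulo m and n; the product carries its additive group structure. *)
Theorem theorem5p1 (m n : nat) (m_gt0 : (0 < m)%N) (n_gt0 : (0 < n)%N)
    (m_ndvd_n : ~~ (m %| n)%N) (gcd_neq1 : gcdn m n <> 1%N)
    (k s r t h l : nat) (d : 'I_k -> nat) (xi : 'I_s -> nat)
    (c : 'I_l -> ('Z_m * 'Z_n)%type)
    (S S' T T' : {fset nat})
    (S_def : S = divisor_set n)
    (S'_def : S' = divisor_set m)
    (d_inj : injective d)
    (d_enum : S = [fset d i | i : 'I_k]%fset)
    (xi_inj : injective xi)
    (xi_enum : S' = [fset xi j | j : 'I_s]%fset)
    (h_def : h = #|` S `&` S'|%fset)
    (k_def : k = (r + h)%N)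
    (s_def : s = (t + h)%N)
    (d_common : (S `&` S')%fset = [fset d i | i : 'I_k & (r <= i)%N]%fset)
    (xi_common : (S `&` S')%fset = [fset xi j | j : 'I_s & (t <= j)%N]%fset)
    (T_def : T = coprime_products S S')
    (T'_def : T' = (T `\` (S `|` S'))%fset)
    (c_inj : injective (fun i => <[c i]>%g))
    (c_enum : forall C : {group 'Z_m * 'Z_n},
       cyclic C -> exists i, C = <[c i]>%g :> {set 'Z_m * 'Z_n}) :
  let G : finGroupType := ('Z_m * 'Z_n)%type in
  let eta := nb_cyclic G in
  let alpha :=
    (\sum_(i < k) eta (d i) * (totient (d i) - 1)
     + \sum_(j < s | j < t) eta (xi j) * (totient (xi j) - 1)
     + \sum_(a <- T') eta a * (totient a - 1))%N in
  char_poly (adjacency_mx (@power_adj G))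
  = (1 + 'X) ^+ alpha * char_poly (quotient_mx c).
Proof.
move=> G eta alpha.
have m_gt1 : (1 < m)%N.
  by rewrite ltn_neqAle m_gt0 andbT; apply: contraNneq m_ndvd_n => <-.
have n_gt1 : (1 < n)%N.
  rewrite ltn_neqAle n_gt0 andbT; apply/eqP => n1.
  by apply: gcd_neq1; rewrite -n1 gcdn1.
have disjS : [disjoint S & (S' `\` S)]%fset.
  by rewrite fdisjoint_sym; apply/fdisjointP=> a; rewrite inE => /andP[].
have disjT : [disjoint (S `|` (S' `\` S)) & T']%fset.
  rewrite T'_def; apply/fdisjointP=> a; rewrite !inE.
  by case: (a \in S); case: (a \in S').
(* The three sums of [alpha] run over the pairwise disjoint sets [S], [S' \ S] and [T'], so they
   merge into one. *)
have -> : alpha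
    = (\sum_(a <- ((S `|` (S' `\` S)) `|` T')%fset)
         nb_cyclic G a * (totient a - 1))%N.
  rewrite /alpha !big_fsetU_disjoint //=; congr (_ + _ + _)%N.
    by rewrite d_enum big_imfset /= ?big_enum // => i j _ _ /d_inj.
  (* The indices from [t] on enumerate the common divisors; as [xi] is injective, those below [t]
     give exactly the rest of [S']. *)
  have -> : (S' `\` S)%fset = [fset xi j | j : 'I_s & (j < t)%N]%fset.
    apply/fsetP=> a; rewrite inE; apply/andP/imfsetP => [[aS aS'] |].
      have /imfsetP[j _ def_a] : a \in [fset xi j | j : 'I_s]%fset.
        by rewrite -xi_enum.
      exists j => //=; rewrite inE ltnNge; apply: contra aS => tj.
      have : a \in (S `&` S')%fset.
        by rewrite xi_common; apply/imfsetP; exists j.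
      by rewrite inE => /andP[].
    case=> j /= jt ->; have xiS' : xi j \in S'.
      by rewrite xi_enum; apply/imfsetP; exists j.
    split=> //; apply/negP=> xiS.
    have : xi j \in (S `&` S')%fset by rewrite inE xiS.
    rewrite xi_common => /imfsetP[i /= ti /xi_inj ji].
    by move: ti jt; rewrite !inE -ji leqNgt => /negPf ->.
  by rewrite big_imfset /= ?big_filter ?big_enum_cond // => i j _ _ /xi_inj.
(* It remains that the merged set contains every element order: such an order lies in [T], hence in
   [S], [S'] or [T']. *)
apply: (char_poly_power_graph c_inj c_enum) => x.
have [u [v [u_n v_m cop_uv ->]]] :=
  dvdn_lcm_coprime_factor m_gt0 n_gt0 (order_Zp_prod_dvd x m_gt1 n_gt1).
have uv_T : (u * v)%N \in T.
  rewrite T_def; apply/imfset2P; exists u; last exists v => //.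
    by rewrite S_def !inE -dvdn_divisors.
  by rewrite S'_def !inE -dvdn_divisors ?v_m.
by rewrite T'_def !inE uv_T; case: (_ \in S); case: (_ \in S').
Qed.
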